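(* Let $f(z)=\sum_{n=0}^{+\infty}a_nz^n$ be a complex power series that converges for every $z\in\mathbb{C}$ and whose sum $f:\mathbb{C}\to\mathbb{C}$ is bounded. Then $f$ is constant. *)

(* Defs.v *)
From Stdlib Require Import Reals.
From Coquelicot Require Import Coquelicot.

(* Main.v *)
Require Import Defs.
From Stdlib Require Import Reals.
From Coquelicot Require Import Coquelicot.
From Stdlib Require Import Lra Lia.

(** The proof rests on the Cauchy estimates: if [|f| <= M] on the circle
    [|z| = r], then [|a k| * r ^ k <= M].  When [f] is bounded by the same [M]
    on every circle, letting [r] grow forces [a k = 0] for all [k > 0], so [f]
    is the constant [a 0].

    The estimate is obtained without contour integration, by discretising
    Cauchy's formula for the coefficients.  Over the [N]-th roots of unity the
    mean of [q ^ j] vanishes for every nontrivial root [q]; hence for a polynomial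
    [P] of degree less than [N] and a primitive root [w], the mean over [j] of
    [P (r * w ^ j) * w ^ (- j * k)] is exactly [a k * r ^ k]
    ([polynomial_coefficient_bound]).  A power series is then replaced by its
    partial sums.  Convergence at the single point [2 * r] bounds
    [|a n| * (2 * r) ^ n] by some [B], so the terms on the circle of radius [r]
    are dominated by [B / 2 ^ n] and the [n]-th remainder is at most [B / 2 ^ n],
    uniformly on that circle ([entire_remainder_bound]).  Consequently the
    partial sums are bounded there by [M + B / 2 ^ n], and [n] tends to infinity
    in the polynomial estimate ([cauchy_estimate]). *)

Local Open Scope C_scope.

(** * Finite sums of complex numbers *)

Lemma pow_n_Cpow (z : C) (k : nat) : pow_n (K := C_Ring) z k = z ^ k.
Proof.
  induction k as [|k IH]; [reflexivity|].
  simpl. rewrite IH. reflexivity.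
Qed.

Lemma Cmod_sum_n_le (u : nat -> C) (M : R) (n : nat) :
  (forall j, (j <= n)%nat -> (Cmod (u j) <= M)%R) ->
  (Cmod (sum_n u n)%C <= INR (S n) * M)%R.
Proof.
  intros Hu; induction n as [|n IH].
  - rewrite sum_O. specialize (Hu 0%nat (le_n 0)). simpl; lra.
  - rewrite sum_Sn, S_INR.
    apply Rle_trans with (1 := Cmod_triangle _ _).
    assert (H1 := IH (fun j Hj => Hu j (le_S _ _ Hj))).
    assert (H2 := Hu (S n) (le_n _)). lra.
Qed.

Lemma sum_n_single (u : nat -> C) (k n : nat) :
  (k <= n)%nat ->
  (forall m, (m <= n)%nat -> m <> k -> u m = 0) ->
  sum_n u n = u k.
Proof.
  revert k; induction n as [|n IH]; intros k Hk Hu.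
  - rewrite sum_O. now replace k with 0%nat by lia.
  - rewrite sum_Sn. destruct (Nat.eq_dec k (S n)) as [->|Hne].
    + rewrite (sum_n_ext_loc u (fun _ => zero)).
      * unfold sum_n; rewrite sum_n_m_const_zero. apply Cplus_0_l.
      * intros m Hm. apply Hu; lia.
    + rewrite (IH k), (Hu (S n)); try lia.
      * apply Cplus_0_r.
      * intros m Hm Hmk. apply Hu; lia.
Qed.

Lemma sum_n_Cmult_l (c : C) (u : nat -> C) (n : nat) :
  sum_n (fun k => c * u k) n = c * sum_n u n.
Proof. exact (sum_n_mult_l (K := C_Ring) c u n). Qed.

(** * Roots of unity *)

(** Multiplying the geometric sum by [q - 1] telescopes it to
    [q ^ S n - 1 = 0], and [q - 1] is invertible. *)
Lemma sum_n_root_of_unity (q : C) (n : nat) :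
  q ^ S n = 1 -> q <> 1 -> sum_n (fun j => q ^ j) n = RtoC 0.
Proof.
  intros Hq Hq1.
  assert (Htel : forall m, (q - 1) * sum_n (fun j => q ^ j) m = q ^ S m - 1).
  { induction m as [|m IH].
    - rewrite sum_O. simpl. ring.
    - rewrite sum_Sn. change plus with Cplus.
      rewrite Cmult_plus_distr_l, IH, !Cpow_S. ring. }
  assert (Hnz : q - 1 <> 0).
  { intros H. apply Hq1. replace q with (q - 1 + 1) by ring. rewrite H. ring. }
  specialize (Htel n). rewrite Hq in Htel.
  set (s := sum_n _ n : C) in *. change (s = 0).
  replace s with (/ (q - 1) * ((q - 1) * s)) by (field; exact Hnz).
  rewrite Htel. ring.
Qed.

Definition cis (t : R) : C := (cos t, sin t).

Lemma cis_pow (t : R) (k : nat) : cis t ^ k = cis (INR k * t).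
Proof.
  induction k as [|k IH].
  - unfold cis; simpl. rewrite Rmult_0_l, cos_0, sin_0. reflexivity.
  - rewrite Cpow_S, IH, S_INR. unfold cis, Cmult; simpl.
    replace ((INR k + 1) * t)%R with (t + INR k * t)%R by ring.
    rewrite cos_plus, sin_plus. f_equal; ring.
Qed.

Lemma Cmod_cis (t : R) : Cmod (cis t) = 1%R.
Proof.
  unfold Cmod, cis; simpl fst; simpl snd.
  rewrite <- !Rsqr_pow2, Rplus_comm, sin2_cos2. exact sqrt_1.
Qed.

(** The root is [exp (2 i PI / S n)].  Its power [d] has real part
    [cos (2 h) = 1 - 2 * sin h ^ 2] with [h = d * PI / S n]; this is less than
    [1] because [h] lies strictly between [0] and [PI]. *)
Lemma primitive_root_exists (n : nat) :
  exists w : C, Cmod w = 1%R /\ w ^ S n = 1 /\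
    forall d, (0 < d < S n)%nat -> w ^ d <> 1.
Proof.
  assert (HN : (0 < INR (S n))%R) by (apply lt_0_INR; lia).
  assert (Hpi := PI_RGT_0).
  exists (cis (2 * PI / INR (S n))). split; [apply Cmod_cis|]. split.
  - rewrite cis_pow.
    replace (INR (S n) * (2 * PI / INR (S n)))%R with (2 * PI)%R by (field; lra).
    unfold cis. rewrite cos_2PI, sin_2PI. reflexivity.
  - intros d [Hd0 HdN] Heq. rewrite cis_pow in Heq.
    apply lt_INR in Hd0; simpl in Hd0. apply lt_INR in HdN.
    set (h := (INR d * PI / INR (S n))%R).
    assert (Hh : (INR d * (2 * PI / INR (S n)) = 2 * h)%R)
      by (unfold h; field; lra).
    assert (Hcos : cos (2 * h) = 1%R)
      by (rewrite <- Hh; exact (f_equal fst Heq)).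
    assert (Hpos : (0 < h)%R) by (unfold h; apply Rdiv_lt_0_compat; nra).
    assert (Hlt : (h < PI)%R).
    { unfold h. apply Rmult_lt_reg_r with (INR (S n)); [lra|].
      unfold Rdiv. rewrite Rmult_assoc, Rinv_l; nra. }
    assert (Hsin := sin_gt_0 h Hpos Hlt).
    rewrite cos_2a_sin in Hcos. nra.
Qed.

(** * Coefficients of a polynomial bounded on a circle *)

(** Weighting the values [P (r * w ^ j)] by [(w ^ j) ^ (S n - k)], which is
    [w ^ (- j * k)] written with a natural exponent, and summing over [j] kills
    every monomial except the [k]-th.  There are more sample points than the
    degree, so no other exponent is congruent to [k]. *)
Lemma polynomial_coefficient_bound (a : nat -> C) (n : nat) (r M : R) :
  (0 <= r)%R ->
  (forall z, Cmod z = r -> (Cmod (sum_n (fun m => a m * z ^ m) n)%C <= M)%R) ->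
  forall k, (k <= n)%nat -> (Cmod (a k) * r ^ k <= M)%R.
Proof.
  intros Hr HM k Hk.
  destruct (primitive_root_exists n) as (w & Hmod & Hw & Hprim).
  set (P := fun z => sum_n (fun m => a m * z ^ m) n).
  set (e := fun m => w ^ (m + (S n - k))).
  (* Monomial m contributes the geometric sum of ratio [e m], a root of unity
     equal to 1 exactly when m = k. *)
  assert (Hroots : forall m, e m ^ S n = 1).
  { intros m. unfold e.
    now rewrite <- Cpow_mult_r, Nat.mul_comm, Cpow_mult_r, Hw, Cpow_1_l. }
  assert (He1 : e k = 1) by (unfold e; now replace (k + (S n - k))%nat with (S n) by lia).
  assert (He : forall m, (m <= n)%nat -> m <> k -> e m <> 1).
  { intros m Hm Hmk. unfold e.
    destruct (Nat.lt_ge_cases m k) as [Hlt|Hge].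
    - apply Hprim; lia.
    - replace (m + (S n - k))%nat with (S n + (m - k))%nat by lia.
      rewrite Cpow_add_r, Hw, Cmult_1_l. apply Hprim; lia. }
  assert (Hterm : forall m j : nat,
    (w ^ j) ^ (S n - k) * (a m * (RtoC r * w ^ j) ^ m) = a m * RtoC r ^ m * e m ^ j).
  { intros m j. unfold e.
    rewrite Cpow_mult_l, <- !Cpow_mult_r, Nat.mul_add_distr_r, Cpow_add_r.
    rewrite (Nat.mul_comm m j), (Nat.mul_comm (S n - k) j). ring. }
  assert (Hsum : sum_n (fun j => P (RtoC r * w ^ j) * (w ^ j) ^ (S n - k)) n
                 = a k * RtoC r ^ k * RtoC (INR (S n))).
  { transitivity (sum_n (fun m => a m * RtoC r ^ m * sum_n (fun j => e m ^ j) n) n).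
    - rewrite (sum_n_ext _ (fun j => sum_n (fun m => a m * RtoC r ^ m * e m ^ j) n)).
      + rewrite sum_n_switch. apply sum_n_ext; intros m. apply sum_n_Cmult_l.
      + intros j. unfold P. rewrite Cmult_comm, <- sum_n_Cmult_l.
        apply sum_n_ext; intros m. apply Hterm.
    - rewrite (sum_n_single _ k n Hk).
      + f_equal. rewrite He1.
        rewrite (sum_n_ext _ (fun _ => RtoC 1)) by (intros j; apply Cpow_1_l).
        clear. induction n as [|n IH].
        * rewrite sum_O. reflexivity.
        * rewrite sum_Sn, IH, (S_INR (S n)), RtoC_plus. reflexivity.
      + intros m Hm Hmk.
        rewrite (sum_n_root_of_unity _ _ (Hroots m) (He m Hm Hmk)). apply Cmult_0_r. }
  assert (Hle : (Cmod (a k * RtoC r ^ k * RtoC (INR (S n)))%C <= INR (S n) * M)%R).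
  { rewrite <- Hsum. apply Cmod_sum_n_le; intros j _.
    rewrite Cmod_mult, !Cmod_pow, Hmod, !pow1, Rmult_1_r.
    apply HM. rewrite Cmod_mult, Cmod_pow, Hmod, pow1, Cmod_R, Rabs_pos_eq; lra. }
  assert (HN : (0 < INR (S n))%R) by (apply lt_0_INR; lia).
  rewrite !Cmod_mult, Cmod_pow, !Cmod_R, !Rabs_pos_eq in Hle by lra.
  apply Rmult_le_reg_l with (INR (S n)); lra.
Qed.


(** * Uniform remainder bounds for power series *)

Lemma is_pseries_partial_sums (a : nat -> C) (z l : C) :
  is_pseries a z l ->
  filterlim (fun n => sum_n (fun k => a k * z ^ k) n) eventually
    (locally (T := C_NormedModule) l).
Proof.
  intros H. eapply filterlim_ext; [|exact H].
  intros n; simpl. apply sum_n_ext; intros k.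
  rewrite pow_n_Cpow. apply Cmult_comm.
Qed.

Lemma Cmod_limit_le (u : nat -> C) (l c : C) (B : R) :
  filterlim u eventually (locally (T := C_NormedModule) l) ->
  eventually (fun n => (Cmod (u n - c)%C <= B)%R) ->
  (Cmod (l - c)%C <= B)%R.
Proof.
  intros Hu HB.
  refine (filterlim_le (F := eventually) (fun n => Cmod (u n - c)%C) (fun _ => B)
            (Cmod (l - c)%C) B HB _ (filterlim_const B)).
  refine (filterlim_comp _ _ _ (fun n => u n - c) Cmod _ _ _ _
            (filterlim_norm (V := C_NormedModule) (l - c))).
  exact (filterlim_comp_2 _ _ _ Hu (filterlim_const (- c))
           (filterlim_plus (V := C_NormedModule) l (- c))).
Qed.

(** Convergent partial sums are bounded, and each term is the difference of two
    consecutive ones. *)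
Lemma pseries_terms_bounded (a : nat -> C) (z l : C) :
  is_pseries a z l ->
  exists B : R, forall n, (Cmod (a n) * Cmod z ^ n <= B)%R.
Proof.
  intros H. apply is_pseries_partial_sums in H.
  destruct (filterlim_bounded (V := C_NormedModule) _ (ex_intro _ l H)) as [B HB].
  change (forall n, (Cmod (sum_n (fun k => a k * z ^ k) n)%C <= B)%R) in HB.
  exists (2 * B)%R. intros n.
  rewrite <- Cmod_pow, <- Cmod_mult.
  assert (HB0 := Rle_trans _ _ _ (Cmod_ge_0 _) (HB 0%nat)).
  destruct n as [|n].
  - specialize (HB 0%nat). rewrite sum_O in HB. lra.
  - assert (H1 := HB n). assert (H2 := HB (S n)).
    rewrite sum_Sn in H2. change plus with Cplus in H2.
    set (s := sum_n _ _) in *. set (t := a (S n) * z ^ S n) in *.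
    replace t with ((s + t) + - s) by ring.
    apply Rle_trans with (1 := Cmod_triangle _ _).
    rewrite Cmod_opp. lra.
Qed.

(** The hypothesis gives [|a k * z ^ k| <= B / 2 ^ k], and the tail beyond [n] of
    that geometric series sums to [B / 2 ^ n]. *)
Lemma pseries_remainder_bound (a : nat -> C) (z l : C) (B : R) :
  is_pseries a z l ->
  (forall n, (Cmod (a n) * (2 * Cmod z) ^ n <= B)%R) ->
  forall n, (Cmod (l - sum_n (fun k => a k * z ^ k) n)%C <= B / 2 ^ n)%R.
Proof.
  intros Hl HB n.
  apply (Cmod_limit_le _ _ _ _ (is_pseries_partial_sums _ _ _ Hl)).
  exists n. intros N HN.
  assert (HB0 : (0 <= B)%R).
  { apply Rle_trans with (2 := HB 0%nat). simpl. rewrite Rmult_1_r. apply Cmod_ge_0. }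
  assert (Hpos : forall m, (0 < / 2 ^ m)%R)
    by (intros m; apply Rinv_0_lt_compat, pow_lt; lra).
  (* The exact value of the finite geometric tail is what makes the
     induction on N go through. *)
  enough (H : (Cmod (sum_n (fun k => a k * z ^ k) N - sum_n (fun k => a k * z ^ k) n)%C
               <= B / 2 ^ n - B / 2 ^ N)%R).
  { specialize (Hpos N). unfold Rdiv in *. nra. }
  induction HN as [|N HN IH].
  - unfold Cminus. rewrite Cplus_opp_r, Cmod_0. lra.
  - rewrite sum_Sn. change plus with Cplus.
    set (s := sum_n _ N) in *. set (s0 := sum_n _ n) in *.
    replace (s + a (S N) * z ^ S N - s0) with ((s - s0) + a (S N) * z ^ S N) by ring.
    apply Rle_trans with (1 := Cmod_triangle _ _).
    rewrite Cmod_mult, Cmod_pow.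
    assert (HS := HB (S N)). rewrite Rpow_mult_distr in HS.
    assert (Ht : (Cmod (a (S N)) * Cmod z ^ S N <= B / 2 ^ S N)%R).
    { apply Rmult_le_reg_r with (2 ^ S N)%R; [apply pow_lt; lra|].
      unfold Rdiv. rewrite (Rmult_assoc B), Rinv_l by (apply pow_nonzero; lra). lra. }
    replace (B / 2 ^ N)%R with (2 * (B / 2 ^ S N))%R in IH
      by (simpl; field; apply pow_nonzero; lra).
    lra.
Qed.

(** Convergence at one point of modulus [2 * r] controls the whole circle of
    radius [r], which is why [B] can be chosen independently of [z]. *)
Lemma entire_remainder_bound (a : nat -> C) (f : C -> C) (r : R) :
  (forall z, is_pseries a z (f z)) -> (0 <= r)%R ->
  exists B : R, forall n z, Cmod z = r ->
    (Cmod (f z - sum_n (fun k => a k * z ^ k) n)%C <= B / 2 ^ n)%R.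
Proof.
  intros Hf Hr.
  destruct (pseries_terms_bounded _ _ _ (Hf (RtoC (2 * r)))) as [B HB].
  exists B. intros n z Hz. apply pseries_remainder_bound; [apply Hf|].
  intros m. rewrite Hz. rewrite Cmod_R, Rabs_pos_eq in HB by lra. apply HB.
Qed.

(** * Cauchy estimates and vanishing of the coefficients *)

Lemma le_of_le_plus_geometric (x y B : R) (n0 : nat) :
  (forall n, (n0 <= n)%nat -> (x <= y + B / 2 ^ n)%R) -> (x <= y)%R.
Proof.
  intros H.
  assert (Hlim : is_lim_seq (fun n => y + B * (/ 2) ^ n)%R (y + B * 0)%R).
  { apply is_lim_seq_plus'; [apply is_lim_seq_const|].
    apply is_lim_seq_mult'; [apply is_lim_seq_const|].
    apply is_lim_seq_geom. rewrite Rabs_pos_eq; lra. }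
  rewrite Rmult_0_r, Rplus_0_r in Hlim.
  refine (is_lim_seq_le_loc (fun _ => x) _ x y _ (is_lim_seq_const x) Hlim).
  exists n0. intros n Hn. rewrite pow_inv. exact (H n Hn).
Qed.

(** On the circle the [n]-th partial sum is bounded by [M + B / 2 ^ n], so the
    polynomial bound holds with that constant for every [n >= k]. *)
Lemma cauchy_estimate (a : nat -> C) (f : C -> C) (r M : R) :
  (forall z, is_pseries a z (f z)) -> (0 <= r)%R ->
  (forall z, Cmod z = r -> (Cmod (f z) <= M)%R) ->
  forall k, (Cmod (a k) * r ^ k <= M)%R.
Proof.
  intros Hf Hr HM k.
  destruct (entire_remainder_bound a f r Hf Hr) as [B HB].
  apply le_of_le_plus_geometric with B k. intros n Hn.
  apply polynomial_coefficient_bound with n; [exact Hr| |exact Hn].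
  intros z Hz. specialize (HB n z Hz). specialize (HM z Hz).
  set (p := sum_n _ _) in *.
  replace p with (f z + - (f z - p)) by ring.
  apply Rle_trans with (1 := Cmod_triangle _ _). rewrite Cmod_opp. lra.
Qed.

Lemma bounded_entire_coefficient_zero (a : nat -> C) (f : C -> C) (M : R) :
  (forall z, is_pseries a z (f z)) ->
  (forall z, (Cmod (f z) <= M)%R) ->
  forall k, (0 < k)%nat -> a k = 0.
Proof.
  intros Hf HM k Hk. apply Cmod_eq_0.
  destruct (Cmod_ge_0 (a k)) as [Hpos|Heq]; [exfalso|now symmetry].
  assert (HM0 := Rle_trans _ _ _ (Cmod_ge_0 _) (HM 0)).
  (* This radius makes |a k| * r = |a k| + M exceed M, while r >= 1 gives
     r <= r ^ k. *)
  set (r := (1 + M / Cmod (a k))%R).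
  assert (Hr : (1 <= r)%R).
  { unfold r. assert (0 <= M / Cmod (a k))%R by now apply Rdiv_le_0_compat. lra. }
  assert (Hest := cauchy_estimate a f r M Hf ltac:(lra) (fun z _ => HM z) k).
  assert (Hrk : (r <= r ^ k)%R).
  { rewrite <- (pow_1 r) at 1. apply Rle_pow; [exact Hr|lia]. }
  assert (Har : (Cmod (a k) * r = Cmod (a k) + M)%R) by (unfold r; field; lra).
  nra.
Qed.

Theorem theorem3p12 (a : nat -> C) (f : C -> C)
  (f_sum : forall z : C, is_pseries a z (f z))
  (f_bounded : exists M : R, forall z : C, (Cmod (f z) <= M)%R) :
  exists c : C, forall z : C, f z = c.
Proof.
  destruct f_bounded as [M HM]. exists (a 0%nat). intros z.
  assert (Ha := bounded_entire_coefficient_zero a f M f_sum HM).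
  assert (H : (Cmod (f z - a 0%nat)%C <= 0)%R).
  { apply (Cmod_limit_le _ _ _ _ (is_pseries_partial_sums _ _ _ (f_sum z))).
    exists 0%nat. intros n _.
    rewrite (sum_n_single _ 0 n).
    - simpl. replace (a 0%nat * 1 - a 0%nat) with (RtoC 0) by ring.
      rewrite Cmod_0. lra.
    - lia.
    - intros m _ Hm. rewrite Ha by lia. ring. }
  assert (H0 : f z - a 0%nat = 0)
    by (apply Cmod_eq_0, Rle_antisym; [exact H|apply Cmod_ge_0]).
  replace (f z) with (f z - a 0%nat + a 0%nat) by ring. rewrite H0. ring.
Qed.
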